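(* Let $\Gamma$ be a connected graph with minimum valency one, and let $n$ be its number of vertices. Then $\Gamma$ has three (distinct) $\mathcal{L}$-eigenvalues if and only if it is a star graph or a cone over the disjoint union of an isolated vertex and a conference graph. The latter has non-trivial $\mathcal{L}$-eigenvalues $\frac{n\pm\sqrt{n-2}}{n-1}$, each with multiplicity $\frac{n-1}{2}$.
   Context: All graphs are finite, simple and undirected. $d_u$ denotes the valency (degree) of vertex $u$. The normalized Laplacian of a graph is the matrix $\mathcal{L}=[\ell_{uv}]$ indexed by the vertices with $\ell_{uu}=1$ if $d_u\neq 0$, $\ell_{uv}=-1/\sqrt{d_ud_v}$ if $u$ and $v$ are adjacent, and $\ell_{uv}=0$ otherwise. Its eigenvalues are called the $\mathcal{L}$-eigenvalues of the graph; for a connected graph the trivial $\mathcal{L}$-eigenvalue $0$ has multiplicity one, and the other $\mathcal{L}$-eigenvalues are called non-trivial. A star graph is a complete bipartite graph $K_{1,m}$. A cone over a graph $\Gamma'$ is the graph obtained from $\Gamma'$ by adding a new vertex adjacent to all vertices of $\Gamma'$. A graph is strongly regular with parameters $(n',k,\lambda,\mu)$ if it has $n'$ vertices, is $k$-regular with $0<k<n'-1$, and any two distinct vertices have exactly $\lambda$ common neighbors if they are adjacent and exactly $\mu$ otherwise. A conference graph is a strongly regular graph with parameters $(n',k,\lambda,\mu)$ satisfying $n'=2k+1$, $k=2\mu$ and $\lambda=\mu-1$.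
   Formalization: ''Star graph'' is taken to mean K_{1,m} with m at least 2: the star K_2 is connected with minimum valency one but has only the two L-eigenvalues 0 and 2, so the stated equivalence fails for it. *)

(* Defs.v *)
(* MathComp world. *)
From HB Require Import structures.
From mathcomp Require Import all_boot all_order all_algebra.

Set Implicit Arguments.
Unset Strict Implicit.
Unset Printing Implicit Defensive.

Import Order.TTheory GRing.Theory Num.Theory.
Local Open Scope ring_scope.

Record sgraph := SGraph {
  vertex :> finType;
  adj : rel vertex;
  adj_sym : symmetric adj;
  adj_irr : irreflexive adj }.

Definition isomorphic (G H : sgraph) : Prop :=
  exists2 f : G -> H, bijective f & forall x y, adj (f x) (f y) = adj x y.

Definition connected (G : sgraph) : Prop :=
  forall x y : G, connect (@adj G) x y.

Definition neighbors (G : sgraph) (u : G) : {set G} := [set v | adj u v].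

Definition valency (G : sgraph) (u : G) : nat := #|neighbors u|.

Definition minimum_valency (G : sgraph) (d : nat) : Prop :=
  (forall u : G, (d <= valency u)%N) /\ (exists u : G, valency u = d).

Section Constructions.
Variables (G H : sgraph) (m1 m2 : nat).

Definition cone_adj (x y : option G) : bool :=
  match x, y with
  | Some u, Some v => adj u v
  | None, None => false
  | _, _ => true
  end.

Lemma cone_sym : symmetric cone_adj.
Proof. by move=> [u|] [v|] //=; apply: adj_sym. Qed.

Lemma cone_irr : irreflexive cone_adj.
Proof. by move=> [u|] //=; apply: adj_irr. Qed.

Definition cone : sgraph := SGraph cone_sym cone_irr.

Definition disjoint_union_adj (x y : G + H) : bool :=
  match x, y with
  | inl u, inl v => adj u v
  | inr u, inr v => adj u v
  | _, _ => false
  end.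

Lemma disjoint_union_sym : symmetric disjoint_union_adj.
Proof. by move=> [u|u] [v|v] //=; apply: adj_sym. Qed.

Lemma disjoint_union_irr : irreflexive disjoint_union_adj.
Proof. by move=> [u|u] /=; apply: adj_irr. Qed.

Definition disjoint_union : sgraph :=
  SGraph disjoint_union_sym disjoint_union_irr.

Definition bipartite_adj (x y : 'I_m1 + 'I_m2) : bool :=
  match x, y with
  | inl _, inr _ | inr _, inl _ => true
  | _, _ => false
  end.

Lemma bipartite_sym : symmetric bipartite_adj.
Proof. by move=> [u|u] [v|v]. Qed.

Lemma bipartite_irr : irreflexive bipartite_adj.
Proof. by move=> [u|u]. Qed.

Definition complete_bipartite : sgraph := SGraph bipartite_sym bipartite_irr.

End Constructions.

Definition isolated_adj (x y : unit) : bool := false.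

Definition isolated_vertex : sgraph :=
  @SGraph unit isolated_adj (fun _ _ => erefl) (fun _ => erefl).

(* The degenerate case K_{1,1} = K_2 is excluded: its normalized Laplacian
   has only the two eigenvalues 0 and 2. *)
Definition star (G : sgraph) : Prop :=
  exists2 m : nat, (2 <= m)%N & isomorphic G (complete_bipartite 1 m).

Definition strongly_regular (G : sgraph) (n k lambda mu : nat) : Prop :=
  [/\ #|G| = n,
      (0 < k < n - 1)%N,
      forall u : G, valency u = k,
      forall u v : G, u != v -> adj u v ->
        #|neighbors u :&: neighbors v| = lambda &
      forall u v : G, u != v -> ~~ adj u v ->
        #|neighbors u :&: neighbors v| = mu].

(* [mu = lambda + 1] is lambda = mu - 1 without truncated subtraction. *)
Definition conference (G : sgraph) : Prop :=
  exists n k lambda mu : nat,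
    [/\ strongly_regular G n k lambda mu,
        n = (2 * k + 1)%N, k = (2 * mu)%N & mu = (lambda + 1)%N].

Definition cone_over_isolated_and_conference (G : sgraph) : Prop :=
  exists2 C : sgraph, conference C &
    isomorphic G (cone (disjoint_union isolated_vertex C)).

Section NormalizedLaplacian.
Variables (R : rcfType) (G : sgraph).

Definition laplacian_entry (u v : G) : R :=
  if u == v then (if valency u != 0%N then 1 else 0)
  else if adj u v then - 1 / Num.sqrt ((valency u)%:R * (valency v)%:R)
  else 0.

Definition normalized_laplacian : 'M[R]_#|G| :=
  \matrix_(i, j) laplacian_entry (enum_val i) (enum_val j).

Definition Leigenvalue (a : R) : bool := eigenvalue normalized_laplacian a.

(* Algebraic multiplicity. *)
Definition Lmultiplicity (a : R) : nat := mup a (char_poly normalized_laplacian).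

Definition number_of_Leigenvalues (k : nat) : Prop :=
  exists s : seq R,
    [/\ uniq s, size s = k & forall a : R, Leigenvalue a <-> a \in s].

(* To be used for connected graphs only, where the eigenvalue 0 is simple. *)
Definition nontrivial_Leigenvalue (a : R) : Prop := Leigenvalue a /\ a != 0.

End NormalizedLaplacian.

(* Main.v *)
Require Import Defs.
From HB Require Import structures.
From mathcomp Require Import all_boot all_order all_algebra ring lra zify complex.
Import Order.TTheory GRing.Theory Num.Theory.
Local Open Scope ring_scope.
Set Implicit Arguments.
Unset Strict Implicit.
Unset Printing Implicit Defensive.

(** Let [s] be the vector of square roots of the valencies, which spans the
kernel of the normalized Laplacian [L] of a connected graph.  As [L] is
symmetric, its eigenvalues are among 0, t1, t2 iff [(L - t1)(L - t2)] is a
multiple [c] of the rank one matrix [s^T s].  Entrywise, this determines the sum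
of the inverse valencies of the common neighbors of any two vertices.

At a vertex [u] of valency one with neighbor [v], every other vertex [w]
satisfies [1 / d_v = c * d_w], since a right hand side [c * d_w <> 0] forces [w]
to have a common neighbor with [u].  Hence [v] dominates the graph and the vertices
other than [u] and [v] induce a regular graph; the identities between its
vertices say that it is edgeless (a star) or a conference graph.

Conversely, [tr ((L - t1)(L - t2)) = t1 * t2] shows that 0 is a simple
eigenvalue, and then [tr L = n] determines the multiplicities of t1 and t2. *)

(** * Real symmetric matrices and conjugates of diagonal matrices *)

(** Over [R[i]] the matrix is Hermitian, so the spectral theorem diagonalizes it with a real
    diagonal. Diagonalizability then descends to [R], because it only depends on the minimal
    polynomial being a product of distinct linear factors over [R]. *)
Lemma symmetric_diagonalization (R : rcfType) n (A : 'M[R]_n) :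
  A^T = A ->
  exists (P : 'M[R]_n) (d : 'rV[R]_n),
    P \in unitmx /\ A = invmx P *m diag_mx d *m P.
Proof.
case: n A => [|n] A Asym.
  by exists 1%:M, 0; rewrite unitmx1; split=> //; rewrite [LHS]flatmx0 [RHS]flatmx0.
pose toC : {rmorphism R -> R[i]} := real_complex R.
pose AC := map_mx toC A.
have hermA : AC \is hermsymmx.
  apply: realsym_hermsym.
    apply/is_hermitianmxP; rewrite expr0 scale1r.
    by apply/matrixP => i j; rewrite !mxE -[in RHS]Asym mxE.
  by apply/mxOverP => i j; rewrite mxE /= complex_real.
have /orthomx_spectralP defA := hermitian_normalmx hermA.
have /mxOverP real_d := hermitian_spectral_diag_real hermA.
have Punit := spectral_unit AC.
set P := spectralmx AC in defA Punit; set d := spectral_diag AC in defA real_d.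
pose e := map_mx (@complex.Re R) d.
have de : d = map_mx toC e.
  by apply/rowP => i; rewrite !mxE; apply/esym/RRe_real.
(* The minimal polynomial is unchanged by extension of scalars and by conjugation, and that of a
   diagonal matrix has its distinct entries as simple roots; these entries are real. *)
have minA : mxminpoly A %| \prod_(r <- undup [seq e 0 i | i <- enum 'I_n.+1]) ('X - r%:P).
  rewrite -(dvdp_map toC) -mxminpoly_map -/AC defA -conjVmx// mxminpoly_uconj ?unitmx_inv//.
  rewrite -mxminpoly_diag.
  by rewrite de -map_diag_mx mxminpoly_map.
have [Q Qunit /similar_diagPex[f /(similarLR Qunit) Af]] :
    diagonalizable A.
  by apply/diagonalizableP; eexists; [apply: undup_uniq | exact: minA].
by exists Q, f; split=> //; rewrite -conjVmx.
Qed.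

(** Over [{poly F}], multiplication by [P] on the left turns [X - P^-1 D P] into [(X - D) P]; the
    nonzero determinant of [P] is then cancelled. *)
Lemma char_poly_conj_diag (F : fieldType) n (P : 'M[F]_n) (d : 'rV[F]_n) :
  P \in unitmx ->
  char_poly (invmx P *m diag_mx d *m P) = \prod_(i < n) ('X - (d 0 i)%:P).
Proof.
move=> Punit; have <- : char_poly (diag_mx d) = \prod_(i < n) ('X - (d 0 i)%:P).
  rewrite char_poly_trig ?diag_mx_is_trig//.
  by apply: eq_bigr => i _; rewrite mxE eqxx.
pose PX : 'M[{poly F}]_n := map_mx polyC P.
have detPX : \det PX != 0 by rewrite det_map_mx polyC_eq0 -unitfE -unitmxE.
apply: (mulfI detPX); rewrite /char_poly -det_mulmx mulrC -det_mulmx; congr (\det _).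
rewrite /char_poly_mx mulmxBr mulmxBl mul_mx_scalar mul_scalar_mx; congr (_ - _).
by rewrite -!map_mxM !mulmxA mulmxV// mul1mx.
Qed.

Lemma mup_conj_diag (F : fieldType) n (P : 'M[F]_n) (d : 'rV[F]_n) a :
  P \in unitmx ->
  mup a (char_poly (invmx P *m diag_mx d *m P)) = (\sum_(i < n) (d 0%R i == a))%N.
Proof.
move=> Punit; rewrite char_poly_conj_diag//.
have -> : \prod_(i < n) ('X - (d 0 i)%:P) =
    \prod_(y <- [seq d 0 i | i <- enum 'I_n]) ('X - y%:P).
  by rewrite big_map big_enum.
rewrite mu_prod_XsubC count_map -sum1_count big_mkcond big_enum/=.
by apply: eq_bigr => i _; case: (_ == _).
Qed.

Lemma eigenvalue_mup (F : fieldType) n (A : 'M[F]_n) a :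
  eigenvalue A a = (0 < mup a (char_poly A))%N.
Proof.
by rewrite eigenvalue_root_char -XsubC_dvd ?dvdp_XsubCl ?monic_neq0 ?char_poly_monic.
Qed.

Lemma eigenvalue_conj_diag (F : fieldType) n (P : 'M[F]_n) (d : 'rV[F]_n) a :
  P \in unitmx ->
  reflect (exists i, d 0 i = a) (eigenvalue (invmx P *m diag_mx d *m P) a).
Proof.
move=> Punit; rewrite eigenvalue_mup mup_conj_diag// lt0n sum_nat_eq0 negb_forall.
apply: (iffP existsP) => -[j]; first by rewrite eqb0 negbK => /eqP; exists j.
by move=> <-; exists j; rewrite eqxx.
Qed.

Lemma conj_diagM (F : fieldType) n (P : 'M[F]_n) (d e : 'rV[F]_n) :
  P \in unitmx ->
  (invmx P *m diag_mx d *m P) *m (invmx P *m diag_mx e *m P) =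
  invmx P *m diag_mx (\row_i (d 0 i * e 0 i)) *m P.
Proof.
move=> Punit; rewrite !mulmxA mulmxK//.
by rewrite -(mulmxA (invmx P)) mulmx_diag.
Qed.

Lemma conj_diagB (F : fieldType) n (P : 'M[F]_n) (d : 'rV[F]_n) t :
  P \in unitmx ->
  invmx P *m diag_mx d *m P - t%:M = invmx P *m diag_mx (\row_i (d 0 i - t)) *m P.
Proof.
move=> Punit; have {1}-> : t%:M = invmx P *m t%:M *m P.
  by rewrite -mulmxA -scalar_mxC mulmxA mulVmx// mul1mx.
rewrite -mulmxBl -mulmxBr; congr (_ *m _ *m _).
by apply/matrixP => i j; rewrite !mxE; case: (i == j); rewrite ?mulr1n ?mulr0n ?subr0.
Qed.

(** After diagonalization every diagonal entry is an eigenvalue, so it kills one of the three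
    factors. *)
Lemma symmetric_annihilating (R : rcfType) n (A : 'M[R]_n) (t0 t1 t2 : R) :
  A^T = A -> (forall a, eigenvalue A a -> a \in [:: t0; t1; t2]) ->
  (A - t0%:M) *m ((A - t1%:M) *m (A - t2%:M)) = 0.
Proof.
move=> /symmetric_diagonalization[P [d [Punit ->]]] eigA.
rewrite !conj_diagB// !conj_diagM//.
set e := (X in diag_mx X); suff -> : e = 0 by rewrite linear0 mulmx0 mul0mx.
apply/rowP => i; rewrite !mxE.
have /eigA : eigenvalue (invmx P *m diag_mx d *m P) (d 0 i).
  by apply/eigenvalue_conj_diag => //; exists i.
by rewrite !inE => /or3P[]/eqP->; rewrite subrr ?mul0r ?mulr0.
Qed.

(** * Spectrum and quadratic identity with a rank one right hand side *)

Section RankOnePerturbation.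
Variables (R : rcfType) (n : nat) (A : 'M[R]_n) (s : 'rV[R]_n) (c t1 t2 : R).
Hypotheses (Asym : A^T = A) (s_neq0 : s != 0) (sA : s *m A = 0).
Hypotheses (t1_neq0 : t1 != 0) (t2_neq0 : t2 != 0) (t12 : t1 != t2).
Hypothesis Aquad : (A - t1%:M) *m (A - t2%:M) = c *: (s^T *m s).

(** Both sides of [Aquad] are applied to the kernel vector [s]: the left one scales it by [t1 * t2],
    the right one by [c] times its squared norm. *)
Lemma rank_one_coef : c * (s *m s^T) 0 0 = t1 * t2.
Proof.
have sAt t : s *m (A - t%:M) = - (t *: s) by rewrite mulmxBr sA sub0r mul_mx_scalar.
have := congr1 (mulmx s) Aquad.
rewrite mulmxA sAt mulNmx -scalemxAl sAt scalerN opprK scalerA -scalemxAr mulmxA.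
rewrite [s *m s^T]mx11_scalar mul_scalar_mx scalerA => /eqP.
rewrite -subr_eq0 -scalerBl scalemx_eq0 (negPf s_neq0) orbF subr_eq0 => /eqP ->.
by rewrite mxE eqxx mulr1n.
Qed.

Lemma rank_one_spectrum (m := fun a => mup a (char_poly A)) :
  [/\ m 0 = 1%N, (m t1 + m t2 + 1 = n)%N,
      (m t1)%:R * t1 + (m t2)%:R * t2 = \tr A &
      forall a, eigenvalue A a -> a \in [:: 0; t1; t2]].
Proof.
have cE := rank_one_coef.
have [P [d [Punit defA]]] := symmetric_diagonalization Asym.
have trcM (e : 'rV[R]_n) : \tr (invmx P *m diag_mx e *m P) = \sum_i e 0 i.
  rewrite mxtrace_mulC mulmxA mulmxV// mul1mx mxtrace_diag.
  by apply: eq_bigr => i _.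
(* Multiplying [Aquad] by [A] kills its right hand side, since [A *m s^T = 0] by symmetry; hence
   each diagonal entry is a root of [X (X - t1) (X - t2)]. *)
have d_root i : [|| d 0 i == 0, d 0 i == t1 | d 0 i == t2].
  have AM : A *m ((A - t1%:M) *m (A - t2%:M)) = 0.
    by rewrite Aquad -scalemxAr mulmxA -{1}Asym -trmx_mul sA trmx0 mul0mx scaler0.
  move: AM; rewrite defA !conj_diagB// !conj_diagM// => /(congr1 (mulmx P)).
  rewrite mulmxA mulmxA mulmxV// mul1mx mulmx0 => /(congr1 (mulmxr (invmx P))) /=.
  rewrite mulmxK// mul0mx => /matrixP/(_ i i); rewrite !mxE eqxx mulr1n => /eqP.
  by rewrite !mulf_eq0 !subr_eq0.
have mE a : m a = (\sum_(i < n) (d 0%R i == a))%N by rewrite /m defA mup_conj_diag.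
have trM : \sum_i (d 0 i - t1) * (d 0 i - t2) = t1 * t2.
  rewrite -cE -trace_mx11 mxtrace_mulC -mxtraceZ -Aquad defA.
  by rewrite !conj_diagB// conj_diagM// trcM; apply: eq_bigr => i _; rewrite !mxE.
(* In the trace of [Aquad] only the zero diagonal entries contribute, each of them [t1 * t2], and
   the total is [t1 * t2]. *)
have m0 : m 0 = 1%N.
  have : (m 0)%:R * (t1 * t2) = t1 * t2.
    rewrite -[RHS]trM mE natr_sum mulr_suml; apply: eq_bigr => i _.
    case/or3P: (d_root i) => /eqP ->.
    - by rewrite eqxx mul1r !sub0r mulrNN.
    - by rewrite (negPf t1_neq0) subrr !mul0r.
    - by rewrite (negPf t2_neq0) subrr mul0r mulr0.
  move/eqP; rewrite -subr_eq0 -[X in _ - X]mul1r -mulrBl !mulf_eq0.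
  rewrite (negPf t1_neq0) (negPf t2_neq0) !orbF subr_eq0 => /eqP/eqP.
  by rewrite pnatr_eq1 => /eqP.
split=> //.
- rewrite -[X in (_ + X)%N]m0 !mE -!big_split /= -[RHS]card_ord -sum1_card.
  apply: eq_bigr => i _; case/or3P: (d_root i) => /eqP ->; rewrite eqxx.
  + by rewrite ![0 == _]eq_sym (negPf t1_neq0) (negPf t2_neq0).
  + by rewrite (negPf t12) (negPf t1_neq0).
  + by rewrite [t2 == _]eq_sym (negPf t12) (negPf t2_neq0).
- rewrite defA trcM !mE !natr_sum !mulr_suml -big_split /=.
  apply: eq_bigr => i _; case/or3P: (d_root i) => /eqP ->; rewrite ?eqxx.
  + by rewrite ![0 == _]eq_sym (negPf t1_neq0) (negPf t2_neq0) !mul0r addr0.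
  + by rewrite (negPf t12) mul1r mul0r addr0.
  + by rewrite [t2 == _]eq_sym (negPf t12) mul1r mul0r add0r.
- by move=> a; rewrite defA => /eigenvalue_conj_diag[]// i <-; rewrite !inE.
Qed.

End RankOnePerturbation.

(** The product [M] satisfies [M *m A = 0], so its rows lie in the kernel line and [M = k^T *m s]
    for some [k]. Evaluating [s *m M^T] in two ways shows that [k] is the stated multiple of [s]. *)
Lemma symmetric_rank_one (R : rcfType) n (A : 'M[R]_n) (s : 'rV[R]_n) (t1 t2 : R) :
  A^T = A -> s != 0 -> s *m A = 0 ->
  (forall x : 'rV[R]_n, x *m A = 0 -> exists k, x = k *: s) ->
  (forall a, eigenvalue A a -> a \in [:: 0; t1; t2]) ->
  (A - t1%:M) *m (A - t2%:M) = (t1 * t2 / (s *m s^T) 0 0) *: (s^T *m s).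
Proof.
move=> Asym s_neq0 sA kerA eigA; set M := _ *m _.
have ss_neq0 : (s *m s^T) 0 0 != 0.
  apply: contraNneq s_neq0; rewrite mxE => /eqP.
  rewrite psumr_eq0 => [/allP ss0|i _]; last by rewrite mxE -expr2 sqr_ge0.
  apply/eqP/rowP => i; have := ss0 i (mem_index_enum _); rewrite /= !mxE.
  by rewrite -expr2 sqrf_eq0 => /eqP.
have trA t : (A - t%:M)^T = A - t%:M by rewrite linearB /= tr_scalar_mx Asym.
have sAt t : s *m (A - t%:M) = - (t *: s) by rewrite mulmxBr sA sub0r mul_mx_scalar.
have MA : M *m A = 0.
  (* The roots are swapped here because the transposition below reverses the order of the
     factors. *)
  have /symmetric_annihilating -/(_ Asym) : forall a, eigenvalue A a -> a \in [:: 0; t2; t1].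
    by move=> a /eigA; rewrite !inE [(a == t2) || _]orbC.
  move/(congr1 trmx); rewrite !trmx_mul !trA trmx0.
  by rewrite -(scalemx1 _ 0) scale0r subr0.
have [k defM] : exists k : 'rV[R]_n, M = k^T *m s.
  (* The boolean form of the equality allows [xchoose] to pick one multiplier per row. *)
  have kE i : exists k, row i M == k *: s.
    by have [|k ->] := kerA (row i M); [rewrite -row_mul MA row0 | exists k].
  exists (\row_i xchoose (kE i)); apply/row_matrixP => i.
  rewrite row_mul; have -> : row i (\row_j xchoose (kE j))^T = (xchoose (kE i))%:M.
    by apply/rowP => j; rewrite ord1 !mxE eqxx mulr1n.
  by rewrite mul_scalar_mx; apply/eqP/(xchooseP (kE i)).
have : s *m M^T = (t1 * t2) *: s.
  rewrite trmx_mul !trA mulmxA sAt mulNmx -scalemxAl sAt scalerN opprK scalerA.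
  by rewrite mulrC.
rewrite defM trmx_mul trmxK mulmxA [s *m s^T]mx11_scalar mul_scalar_mx => ksE.
rewrite scalemxAl; congr (_ *m s); rewrite -[k](scalerK ss_neq0) ksE scalerA linearZ /=.
by rewrite [_%:M 0 0]mxE eqxx mulr1n mulrC.
Qed.

(** * Kernel and quadratic identity of the normalized Laplacian *)

Section NormalizedLaplacianSpectrum.
Variables (R : rcfType) (G : sgraph).
Local Notation L := (normalized_laplacian R G).
Local Notation val_ u := ((valency u)%:R : R).

(* The entries of [(L - t1)(L - t2) = c s^T s], scaled by [sqrt (d_u * d_v)];
   here [a = 2 - t1 - t2] and [b = (1 - t1) * (1 - t2)]. *)
Definition walk_identity (a b c : R) : Prop := forall u v : G,
  \sum_w (adj u w && adj w v)%:R / val_ w =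
  a * (adj u v)%:R - b * (u == v)%:R * val_ u + c * (val_ u * val_ v).

Lemma valencyE (u : G) : valency u = (\sum_v adj u v)%N.
Proof.
rewrite /valency -sum1_card big_mkcond; apply: eq_bigr => v _.
by rewrite inE; case: adj.
Qed.

Definition sqrt_valency : 'rV[R]_#|G| := \row_i Num.sqrt (val_ (enum_val i)).
Local Notation s := sqrt_valency.

Lemma sum_ord_vertex (V : nmodType) (F : G -> V) :
  \sum_(i < #|G|) F (enum_val i) = \sum_u F u.
Proof. by rewrite -(big_enum_val F). Qed.

Lemma laplacian_sym : L^T = L.
Proof.
apply/matrixP => i j; rewrite !mxE /laplacian_entry eq_sym adj_sym [val_ _ * _]mulrC.
by case: eqP => [->|].
Qed.

Hypothesis valency_gt0 : forall u : G, (0 < valency u)%N.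

Lemma valency_neq0 (u : G) : val_ u != 0.
Proof. by rewrite pnatr_eq0 -lt0n. Qed.

Lemma sqrt_valency_gt0 (u : G) : 0 < Num.sqrt (val_ u).
Proof. by rewrite sqrtr_gt0 ltr0n. Qed.

Lemma sqrt_valency_neq0 (u : G) : Num.sqrt (val_ u) != 0.
Proof. exact/lt0r_neq0/sqrt_valency_gt0. Qed.

Lemma sqr_sqrt_valency (u : G) : Num.sqrt (val_ u) * Num.sqrt (val_ u) = val_ u.
Proof. by rewrite -expr2 sqr_sqrtr ?ler0n. Qed.

(** This is [D^(-1/2) A D^(-1/2)], with [A] the adjacency matrix and [D] the diagonal matrix of
    valencies. *)
Definition normalized_adjacency : 'M[R]_#|G| := \matrix_(i, j)
  ((adj (enum_val i) (enum_val j))%:R / (s 0 i * s 0 j)).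
Local Notation W := normalized_adjacency.

Lemma laplacianE : L = 1%:M - W.
Proof.
apply/matrixP => i j; rewrite !mxE /laplacian_entry (inj_eq enum_val_inj).
have [->|_] := eqVneq i j.
  by rewrite adj_irr mul0r subr0 mulr1n -lt0n valency_gt0.
rewrite mulr0n sub0r sqrtrM ?ler0n// mulNr.
by case: adj; rewrite ?mul1r// mul0r oppr0.
Qed.

Lemma laplacian_trace : \tr L = #|G|%:R.
Proof.
rewrite /mxtrace (eq_bigr (fun=> 1)) ?sumr_const ?card_ord// => i _.
by rewrite mxE /laplacian_entry eqxx -lt0n valency_gt0.
Qed.

Lemma row_mul_laplacian (x : 'rV[R]_#|G|) j :
  (x *m L) 0 j = x 0 j -
    (\sum_(i < #|G|) (adj (enum_val i) (enum_val j))%:R * (x 0 i / s 0 i)) / s 0 j.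
Proof.
rewrite laplacianE mulmxBr mulmx1 !mxE; congr (_ - _).
rewrite mulr_suml; apply: eq_bigr => i _; rewrite !mxE invfM.
by rewrite -!mulrA; ring.
Qed.

Lemma sqrt_valency_ker : s *m L = 0.
Proof.
apply/rowP => j; rewrite row_mul_laplacian !mxE.
rewrite (eq_bigr (fun i : 'I_#|G| => (adj (enum_val j) (enum_val i))%:R)); last first.
  by move=> i _; rewrite !mxE divff ?sqrt_valency_neq0// mulr1 adj_sym.
rewrite (sum_ord_vertex (fun u => (adj (enum_val j) u)%:R)) -natr_sum -valencyE.
by rewrite -{2}sqr_sqrt_valency mulfK ?subrr// sqrt_valency_neq0.
Qed.

(* Maximum principle. *)
Lemma connected_harmonic_const (y : G -> R) : connected G ->
  (forall v, \sum_u (adj u v)%:R * y u = val_ v * y v) ->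
  forall u v, y u = y v.
Proof.
move=> Gconn harm u0 v0.
have [m _ ymax] := arg_maxP y (erefl true : xpredT u0).
suff ym w : y w = y m by rewrite !ym.
have /connectP[p] := Gconn m w.
suff: forall x, y x = y m -> path (@adj G) x p -> w = last x p -> y w = y m.
  by apply.
elim: p => [|z p IHp] x yx /=; first by move=> _ ->.
case/andP=> xz pzp wE; apply: (IHp z) => //.
(* At a vertex attaining the maximum, the nonnegative differences to its neighbors sum to zero by
   harmonicity, so the maximum spreads along edges. *)
have /eqP : \sum_u (adj u x)%:R * (y m - y u) = 0.
  under eq_bigr do rewrite mulrBr; rewrite sumrB harm yx -mulr_suml -natr_sum.
  under eq_bigr do rewrite adj_sym.
  by rewrite -valencyE subrr.
rewrite psumr_eq0 => [/allP/(_ z (mem_index_enum _))|v _]; last first.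
  by rewrite mulr_ge0 ?ler0n// subr_ge0; apply: ymax.
by rewrite /= adj_sym xz mul1r subr_eq0 => /eqP.
Qed.

(** Dividing a kernel vector entrywise by [s] yields a function whose value at each vertex is the
    average over its neighbors; connectedness makes it constant. *)
Lemma laplacian_ker (x : 'rV[R]_#|G|) : connected G -> x *m L = 0 ->
  exists k, x = k *: s.
Proof.
move=> Gconn xL; pose y (u : G) := x 0 (enum_rank u) / s 0 (enum_rank u).
have ycst : forall u v, y u = y v.
  apply: connected_harmonic_const => // v.
  have := congr1 (fun z : 'rV_#|G| => z 0 (enum_rank v)) xL.
  rewrite row_mul_laplacian [RHS]mxE enum_rankK => /eqP; rewrite subr_eq0 => /eqP xE.
  rewrite /y xE !mxE enum_rankK -{1}sqr_sqrt_valency.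
  have -> (t S : R) : t != 0 -> t * t * (S / t / t) = S.
    by move=> t0; field.
  - rewrite -sum_ord_vertex; apply: eq_bigr => i _.
    by rewrite !enum_valK.
  - exact: sqrt_valency_neq0.
have [n0|/card_gt0P[u _]] := posnP #|G|.
  by exists 0; apply/rowP => i; have := ltn_ord i; rewrite {2}n0.
exists (y u); apply/rowP => i; rewrite mxE (ycst u (enum_val i)) /y enum_valK.
by rewrite mulfVK// mxE sqrt_valency_neq0.
Qed.

(** With [L = 1 - W] the product is [W^2 - (2 - t1 - t2) W + (1 - t1)(1 - t2)]. Scaling the entry at
    [i, j] by the nonzero [s 0 i * s 0 j] pairs up all square roots, so the scaled identity is
    equivalent to the original one. *)
Lemma laplacian_quadratic (t1 t2 c : R) :
  (L - t1%:M) *m (L - t2%:M) = c *: (s^T *m s) <->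
  walk_identity (2 - t1 - t2) ((1 - t1) * (1 - t2)) c.
Proof.
have entryE i j : ((L - t1%:M) *m (L - t2%:M)) i j * (s 0 i * s 0 j) =
    \sum_w (adj (enum_val i) w && adj w (enum_val j))%:R / val_ w -
    (2 - t1 - t2) * (adj (enum_val i) (enum_val j))%:R +
    (1 - t1) * (1 - t2) * (enum_val i == enum_val j)%:R * val_ (enum_val i).
  have -> : (L - t1%:M) *m (L - t2%:M) =
      W *m W - (2 - t1 - t2) *: W + ((1 - t1) * (1 - t2))%:M.
    have LE t : L - t%:M = (1 - t)%:M - W.
      by rewrite laplacianE addrAC raddfB.
    rewrite !LE mulmxBl !mulmxBr -scalar_mxM mul_mx_scalar mul_scalar_mx.
    move: (W *m W) W => X Y; apply/matrixP => k l; rewrite !mxE.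
    by case: (k == l); rewrite ?mulr1n ?mulr0n; ring.
  rewrite !mxE (inj_eq enum_val_inj) mulrDl mulrBl; congr (_ - _ + _).
  - rewrite -sum_ord_vertex mulr_suml; apply: eq_bigr => k _.
    rewrite !mxE -mulnb natrM; have := sqrt_valency_neq0 (enum_val k).
    set x := Num.sqrt (val_ (enum_val k)) => x_neq0.
    rewrite -[val_ (enum_val k)]sqr_sqrt_valency -/x.
    by field; rewrite x_neq0 !sqrt_valency_neq0.
  - by field; rewrite !sqrt_valency_neq0.
  - have [->|_] := eqVneq i j; last by rewrite mulr0n !mulr0 !mul0r.
    by rewrite mulr1n sqr_sqrt_valency mulr1.
have rhsE i j : (c *: (s^T *m s)) i j * (s 0 i * s 0 j) =
    c * (val_ (enum_val i) * val_ (enum_val j)).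
  rewrite !mxE big_ord1 !mxE -mulrA mulrACA !sqr_sqrt_valency.
  by rewrite mulrA.
have ss_neq0 i j : s 0 i * s 0 j != 0 by rewrite !mxE mulf_neq0 ?sqrt_valency_neq0.
split=> [E u v|E]; last first.
  apply/matrixP => i j; apply: (mulIf (ss_neq0 i j)).
  by rewrite rhsE entryE E; ring.
have := entryE (enum_rank u) (enum_rank v); rewrite E rhsE !enum_rankK => ->.
by ring.
Qed.

End NormalizedLaplacianSpectrum.

(** * Passage between three eigenvalues and the walk identity *)

Section ThreeEigenvalues.
Variables (R : rcfType) (G : sgraph).
Hypothesis valency_gt0 : forall u : G, (0 < valency u)%N.

Lemma sqrt_valency_row_neq0 (u : G) : sqrt_valency R G != 0.
Proof.
apply/eqP => /rowP/(_ (enum_rank u)); rewrite !mxE enum_rankK; apply/eqP.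
exact: sqrt_valency_neq0.
Qed.

(** Since 0 is an eigenvalue, the other two are nonzero, and [c] is nonzero because its product with
    the squared norm of [s] is [t1 * t2]. The bound on the order, which comes from the degree of the
    characteristic polynomial, later ensures that the base of the cone is nonempty. *)
Lemma three_Leigenvalues_walk_identity (u : G) : connected G ->
  number_of_Leigenvalues R G 3 ->
  (2 < #|G|)%N /\ exists a b c : R, c != 0 /\ walk_identity G a b c.
Proof.
move=> Gconn [r [r_uniq r_size rE]]; have s_neq0 := sqrt_valency_row_neq0 u.
split.
  have all_root : all (root (char_poly (normalized_laplacian R G))) r.
    by apply/allP => a /rE; rewrite /Leigenvalue eigenvalue_root_char.
  have := max_poly_roots (monic_neq0 (char_poly_monic _)) all_root r_uniq.
  by rewrite size_char_poly r_size ltnS.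
have r0 : 0 \in r.
  apply/rE/eigenvalueP; exists (sqrt_valency R G) => //.
  by rewrite sqrt_valency_ker// scale0r.
have perm_r := perm_to_rem r0; have := perm_size perm_r; rewrite r_size.
case def_r: (rem 0 r) perm_r => [|t1 [|t2 [|t3 r']]] //= perm_r _.
have := r_uniq; rewrite (perm_uniq perm_r) /= !inE !negb_or andbT.
case/andP => /andP[t1_neq0 t2_neq0] t12.
have eigL a : eigenvalue (normalized_laplacian R G) a -> a \in [:: 0; t1; t2].
  by move/rE; rewrite (perm_mem perm_r).
set s := sqrt_valency R G in s_neq0.
set c := t1 * t2 / (s *m s^T) 0 0.
exists (2 - t1 - t2), ((1 - t1) * (1 - t2)), c.
have LE : (normalized_laplacian R G - t1%:M) *m (normalized_laplacian R G - t2%:M) =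
    c *: (s^T *m s).
  apply: symmetric_rank_one => //; [exact: laplacian_sym | exact: sqrt_valency_ker |].
  by move=> x; apply: laplacian_ker.
split; last exact/laplacian_quadratic.
have := rank_one_coef s_neq0 (sqrt_valency_ker R valency_gt0) LE.
move/eqP; apply: contraTneq => ->; rewrite mul0r eq_sym mulf_neq0 1?eq_sym//.
Qed.

Lemma walk_identity_spectrum (u : G) (t1 t2 c : R)
    (m := fun a => Lmultiplicity G a) :
  t1 != 0 -> t2 != 0 -> t1 != t2 ->
  walk_identity G (2 - t1 - t2) ((1 - t1) * (1 - t2)) c ->
  [/\ m 0 = 1%N, (m t1 + m t2 + 1 = #|G|)%N,
      (m t1)%:R * t1 + (m t2)%:R * t2 = #|G|%:R &
      forall a, Leigenvalue G a -> a \in [:: 0; t1; t2]].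
Proof.
move=> t1_neq0 t2_neq0 t12 /laplacian_quadratic -/(_ valency_gt0) LE.
rewrite -laplacian_trace//; apply: rank_one_spectrum LE => //.
- exact: laplacian_sym.
- exact: sqrt_valency_row_neq0 u.
- exact: sqrt_valency_ker.
Qed.

End ThreeEigenvalues.

(** * Transport along isomorphisms *)

Lemma isomorphic_sym (G H : sgraph) : isomorphic G H -> isomorphic H G.
Proof.
case=> f [g fK gK] fadj; exists g; first by exists f.
by move=> x y; rewrite -fadj !gK.
Qed.

Lemma isomorphic_trans (G H K : sgraph) :
  isomorphic G H -> isomorphic H K -> isomorphic G K.
Proof.
case=> f fbij fadj [g gbij gadj]; exists (g \o f); first exact: bij_comp.
by move=> x y; rewrite /= gadj fadj.
Qed.

Lemma isomorphic_card (G H : sgraph) : isomorphic G H -> #|G| = #|H|.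
Proof. by case=> f /bij_eq_card. Qed.

Lemma walk_identity_isomorphic (R : rcfType) (G H : sgraph) (a b c : R) :
  isomorphic G H -> walk_identity H a b c -> walk_identity G a b c.
Proof.
case=> f fbij fadj HE.
have valf x : valency (f x) = valency x.
  rewrite !valencyE (reindex f) /=; last exact: onW_bij.
  by apply: eq_bigr => y _; rewrite fadj.
move=> u v; have := HE (f u) (f v).
rewrite (reindex f) /=; last exact: onW_bij.
rewrite fadj !valf (inj_eq (bij_inj fbij)) => <-.
by apply: eq_bigr => w _; rewrite !fadj valf.
Qed.

(** * The walk identity on a cone over an isolated vertex and a graph *)

Section ConeOverIsolated.
Variable C : sgraph.
Local Notation H := (cone (disjoint_union isolated_vertex C)).
Local Notation apex := (None : H).
Local Notation leaf := (Some (inl tt) : H).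
Local Notation base := (fun t : C => Some (inr t) : H).

Lemma sum_cone_vertex (V : nmodType) (F : H -> V) :
  \sum_x F x = F apex + (F leaf + \sum_t F (base t)).
Proof.
rewrite (bigD1 apex) //=; congr (_ + _).
rewrite (reindex_omap Some id) /=; last by case.
rewrite (eq_bigl xpredT) => [|x]; last by rewrite eqxx.
by rewrite big_sumType /= (big_pred1 tt) // => -[].
Qed.

Lemma card_cone : #|H| = #|C|.+2.
Proof. by rewrite card_option card_sum card_unit. Qed.

Lemma valency_apex : valency apex = #|C|.+1.
Proof. by rewrite valencyE sum_cone_vertex /= sum1_card. Qed.

Lemma valency_leaf : valency leaf = 1%N.
Proof. by rewrite valencyE sum_cone_vertex /= big1_eq. Qed.

Lemma valency_base t : valency (base t) = (valency t).+1.
Proof. by rewrite !valencyE sum_cone_vertex. Qed.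

Definition cone_valencyE := (valency_apex, valency_leaf, valency_base).

Lemma card_common_neighbors (t t' : C) :
  #|neighbors t :&: neighbors t'| = (\sum_w (adj t w && adj w t'))%N.
Proof.
rewrite -sum1_card big_mkcond; apply: eq_bigr => w _.
by rewrite !inE [adj t' w]adj_sym; case: (_ && _).
Qed.

End ConeOverIsolated.

(** The identity at pairs containing the leaf makes [C] regular and expresses [a], [b], [c] through
    its order and valency [k]. At pairs of base vertices it then fixes the order and the numbers of
    common neighbors, unless [k = 0]. *)
Lemma cone_walk_identity_conference (R : rcfType) (C : sgraph) (a b c : R) :
  c != 0 -> (0 < #|C|)%N ->
  walk_identity (cone (disjoint_union isolated_vertex C)) a b c ->
  (forall t : C, valency t = 0%N) \/ conference C.
Proof.
move=> c_neq0 /card_gt0P[t0 _] E; set H := cone _ in E.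
pose apex : H := None; pose leaf : H := Some (inl tt); pose base (t : C) : H := Some (inr t).
set k := valency t0; pose m : nat := #|C|.+1.
have m_neq0 : m%:R != 0 :> R by rewrite pnatr_eq0.
have k_neq0 : k.+1%:R != 0 :> R by rewrite pnatr_eq0.
have leaf_apex : 0 = a + c * m%:R.
  have := E leaf apex; rewrite sum_cone_vertex /= !cone_valencyE.
  rewrite big1 => [|t _]; last by rewrite mul0r.
  by rewrite !mul0r mulr0 mulr1 mul0r subr0 mul1r !addr0.
have leaf_leaf : 1 / m%:R = - b + c.
  have := E leaf leaf; rewrite sum_cone_vertex /= !cone_valencyE.
  rewrite big1 => [|t _]; last by rewrite mul0r.
  by rewrite mul0r mulr0 !mulr1 !addr0 add0r.
have leaf_base (t : C) : 1 / m%:R = c * (valency t).+1%:R.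
  have := E leaf (base t); rewrite sum_cone_vertex /= !cone_valencyE.
  rewrite big1 => [|t' _]; last by rewrite mul0r.
  by rewrite !mul0r !mulr0 !mul0r subr0 !mul1r !(addr0, add0r).
have kE (t : C) : valency t = k.
  have := etrans (esym (leaf_base t)) (leaf_base t0).
  by move/(mulfI c_neq0)/eqP; rewrite eqr_nat eqSS => /eqP.
have cE : c = (m%:R * k.+1%:R)^-1.
  by rewrite invfM -[m%:R^-1]div1r (leaf_base t0) mulfK.
have aE : a = - k.+1%:R^-1.
  apply/eqP; rewrite -subr_eq0 opprK; apply/eqP; rewrite [RHS]leaf_apex cE.
  by field; rewrite nat1r k_neq0 m_neq0.
have bE : b = - k%:R / (m%:R * k.+1%:R).
  have -> : b = c - 1 / m%:R by rewrite leaf_leaf; ring.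
  by rewrite cE; field; rewrite nat1r k_neq0 m_neq0.
(* This is the identity at two base vertices multiplied by [m * k.+1], with negative terms moved
   across so that it holds in [nat]. The first summand [k.+1] comes from the apex, a common neighbor
   of valency [m]. *)
have base_base (t t' : C) : (k.+1 + m * (\sum_w (adj t w && adj w t')) + m * adj t t' =
    k * k.+1 * (t == t') + k.+1 * k.+1)%N.
  have := E (base t) (base t'); rewrite sum_cone_vertex /= !cone_valencyE !kE.
  under eq_bigr => w _ do rewrite valency_base kE.
  rewrite -mulr_suml -natr_sum mul0r add0r /base -/m.
  have -> : (Some (inr t) == Some (inr t') :> H) = (t == t') by [].
  rewrite cE aE bE; set cn := (\sum_w _)%N => EE.
  apply/eqP; rewrite -(eqr_nat R); apply/eqP.
  have := congr1 ( *%R (m%:R * k.+1%:R)) EE.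
  rewrite -[k.+1]addn1 !(natrD, natrM) => EE'.
  have {}EE' : k%:R + 1 + m%:R * cn%:R = - (m%:R * (adj t t')%:R) +
     k%:R * (k%:R + 1) * (t == t')%:R + (k%:R + 1) * (k%:R + 1) :> R.
    apply: etrans (etrans EE' _); first by field; rewrite natr1 k_neq0 m_neq0.
    by field; rewrite natr1 k_neq0 m_neq0.
  by rewrite EE'; ring.
have [k0|k_gt0] := posnP k; first by left=> t; rewrite kE.
(* On the diagonal the sum is [k], and [base_base] becomes [m * k = 2 * k * k.+1]. *)
have m_eq : m = (2 * k.+1)%N.
  have := base_base t0 t0; rewrite eqxx adj_irr.
  have -> : (\sum_w (adj t0 w && adj w t0) = k)%N.
    rewrite /k valencyE; apply: eq_bigr => w _.
    by rewrite [adj w t0]adj_sym andbb.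
  by nia.
have cn_adj (t t' : C) : t != t' -> adj t t' ->
    (2 * (\sum_w (adj t w && adj w t')).+1 = k)%N.
  by move=> tt' att'; have := base_base t t'; rewrite (negPf tt') att' m_eq; nia.
have cn_nonadj (t t' : C) : t != t' -> ~~ adj t t' ->
    (2 * (\sum_w (adj t w && adj w t')) = k)%N.
  by move=> tt' /negPf att'; have := base_base t t'; rewrite (negPf tt') att' m_eq; nia.
(* An actual edge is needed to obtain [lambda] as a natural number [l] with [k = 2 * l.+1], so that
   [mu = l.+1]. *)
have [t1 t01] : exists t1, adj t0 t1.
  by have /card_gt0P[t1] := k_gt0; rewrite inE; exists t1.
have := cn_adj t0 t1; set l := (\sum_w _)%N => lE.
have {}lE : (2 * l.+1 = k)%N.
  by apply: lE => //; apply: contraTneq t01 => ->; rewrite adj_irr.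
have cardC : #|C| = (2 * k + 1)%N by move: m_eq; rewrite /m; lia.
right; exists #|C|, k, l, l.+1; split; [|by [] | by lia | by lia].
split=> //; first by lia.
- by move=> t t' tt' att'; rewrite card_common_neighbors; have := cn_adj t t' tt' att'; lia.
- by move=> t t' tt' att'; rewrite card_common_neighbors; have := cn_nonadj t t' tt' att'; lia.
Qed.

(** * Recovering the cone from a vertex of valency one, and the edgeless case *)

Section DominatedLeaf.
Variables (G : sgraph) (u v : G).
Hypothesis adj_u : forall x, adj u x = (x == v).
Hypothesis adj_v : forall x, adj v x = (x != v).

Definition base_vertex := {x : G | (x != u) && (x != v)}.

Definition base_adj (x y : base_vertex) : bool := adj (val x) (val y).

Lemma base_sym : symmetric base_adj.
Proof. by move=> x y; apply: adj_sym. Qed.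

Lemma base_irr : irreflexive base_adj.
Proof. by move=> x; apply: adj_irr. Qed.

Definition base_graph := SGraph base_sym base_irr.

Lemma dominated_leaf_cone :
  isomorphic G (cone (disjoint_union isolated_vertex base_graph)).
Proof.
have uv : u != v by apply: contraFN (adj_irr u) => /eqP uv; rewrite {2}uv adj_u.
apply: isomorphic_sym.
exists (fun x : cone (disjoint_union isolated_vertex base_graph) =>
  match x with None => v | Some (inl _) => u | Some (inr t) => val t end).
(* In the inverse, [insub] is reached only for vertices other than [u] and [v], where it
   succeeds. *)
- exists (fun x : G => (if x == v then None else if x == u then Some (inl tt)
    else omap inr (insub x : option base_vertex)) : option (unit + base_vertex)).
  + case=> [[[]|t]|] /=; rewrite ?eqxx ?(negPf uv) //.
    by have /andP[/negPf -> /negPf ->] := valP t; rewrite valK.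
  + move=> x; have [->|xv] := eqVneq x v; first by [].
    have [->|xu] := eqVneq x u; first by [].
    by rewrite insubT ?xu ?xv.
- have nadj_u (t : base_graph) : adj u (val t) = false.
    by have /andP[_ /negPf] := valP t; rewrite adj_u.
  have adj_vt (t : base_graph) : adj v (val t).
    by have /andP[_] := valP t; rewrite adj_v.
  have avu : adj v u by rewrite adj_v.
  case=> [[[]|t]|] [[[]|t']|] //=; rewrite ?adj_irr ?nadj_u ?adj_vt ?avu //.
  + by rewrite adj_u eqxx.
  + by rewrite adj_sym nadj_u.
  + by rewrite adj_sym adj_vt.
Qed.

End DominatedLeaf.

Lemma leaf_walk_identity_cone (R : rcfType) (G : sgraph) (u : G) (a b c : R) :
  (forall x : G, 0 < valency x)%N -> valency u = 1%N -> c != 0 ->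
  walk_identity G a b c ->
  exists C, isomorphic G (cone (disjoint_union isolated_vertex C)).
Proof.
move=> valency_gt0 valency_u c_neq0 E.
have /cards1P[v Nu] : #|neighbors u| == 1%N by rewrite -/(valency u) valency_u.
have adj_u x : adj u x = (x == v) by rewrite -in_set1 -Nu inE.
exists (base_graph u v); apply: dominated_leaf_cone => // x.
have [->|xv] := eqVneq x v; first by rewrite adj_irr.
have [->|xu] := eqVneq x u; first by rewrite adj_sym adj_u eqxx.
(* Only [w = v] can contribute to the sum. If [v] and [x] were not adjacent, the identity would read
   [0 = c * d_u * d_x], which has a nonzero right hand side. *)
have := E u x; rewrite adj_u (negPf xv) eq_sym (negPf xu) (bigD1 v) //= adj_u eqxx.
rewrite big1 ?addr0 => [|w /negPf wv]; last by rewrite adj_u wv mul0r.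
rewrite !mulr0 mul0r subr0 add0r; case: (adj v x) => //=; rewrite mul0r => /esym/eqP.
by rewrite !mulf_eq0 (negPf c_neq0) !(negPf (valency_neq0 _ _ _)).
Qed.

Lemma cone_edgeless_star (C : sgraph) :
  (0 < #|C|)%N -> (forall t : C, valency t = 0%N) ->
  star (cone (disjoint_union isolated_vertex C)).
Proof.
move=> C_gt0 C0; have nadj (t t' : C) : adj t t' = false.
  apply/negbTE/negP => tt'; suff : (0 < valency t)%N by rewrite C0.
  by apply/card_gt0P; exists t'; rewrite inE.
exists #|disjoint_union isolated_vertex C|; first by rewrite card_sum card_unit.
exists (fun x : cone (disjoint_union isolated_vertex C) =>
  if x is Some t then inr (enum_rank t) else inl ord0).
- exists (fun x => if x is inr i then Some (enum_val i) else None).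
  + by case=> [x|] //=; rewrite enum_rankK.
  + by case=> [j|j] /=; [rewrite [j]ord1 | rewrite enum_valK].
- by case=> [[t|t]|] [[t'|t']|] //=; rewrite nadj.
Qed.

(** * Walk identities of the two families *)

(** The constants belong to [t1 = 1] and [t2 = 2]; the squared norm of [s] is the valency sum
    [2 * m], so [c = t1 * t2 / (2 * m)]. *)
Lemma star_walk_identity (R : rcfType) (m : nat) : (0 < m)%N ->
  walk_identity (complete_bipartite 1 m) (-1 : R) 0 m%:R^-1.
Proof.
move=> m_gt0; have m_neq0 : m%:R != 0 :> R by rewrite pnatr_eq0 -lt0n.
pose H := complete_bipartite 1 m.
have sumH (V : nmodType) (F : H -> V) : \sum_x F x = F (inl ord0) + \sum_i F (inr i).
  by rewrite big_sumType /= big_ord1.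
have val0 : valency (inl ord0 : H) = m.
  by rewrite valencyE sumH /= sum1_card card_ord.
have val1 i : valency (inr i : H) = 1%N by rewrite valencyE sumH /= big1_eq.
move=> [x|x] [y|y]; rewrite ?[x]ord1 ?[y]ord1 sumH /= ?val0 ?val1.
- rewrite (eq_bigr (fun=> 1)) => [|i _]; last by rewrite val1 divr1.
  by rewrite sumr_const card_ord; field.
- by rewrite big1 => [|i _]; [field | rewrite mul0r].
- by rewrite big1 => [|i _]; [field | rewrite mul0r].
- by rewrite big1 => [|i _]; [field | rewrite mul0r].
Qed.

(** The last hypothesis covers adjacent and nonadjacent pairs at once: they have [k / 2 - 1] and
    [k / 2] common neighbors. The apex has valency [2 * K] and each base vertex [K], which reduces
    every case to a rational identity in [K]. *)
Lemma conference_cone_walk_identity (R : rcfType) (C : sgraph) (k : nat)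
    (K : R := k.+1%:R) :
  #|C| = (2 * k + 1)%N -> (forall t : C, valency t = k) ->
  (forall t t' : C, t != t' ->
     (2 * (#|neighbors t :&: neighbors t'| + adj t t') = k)%N) ->
  walk_identity (cone (disjoint_union isolated_vertex C))
    (- K^-1) ((1 - K) / (2 * K ^+ 2)) ((2 * K ^+ 2)^-1).
Proof.
move=> cardC valC common; have K_neq0 : K != 0 by rewrite pnatr_eq0.
have cardCR : #|C|.+1%:R = 2 * K.
  by rewrite cardC /K -addn1 -[k.+1]addn1 !(natrD, natrM); ring.
have kE : k%:R = K - 1 by rewrite /K -natr1 addrK.
have valR (t : C) : (valency t).+1%:R = K by rewrite valC.
have sumN (t : C) (F : C -> R) : (forall w, F w = (adj t w)%:R / K) ->
    \sum_w F w = (K - 1) / K.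
  move=> FE; rewrite (eq_bigr _ (fun w _ => FE w)) -mulr_suml -natr_sum.
  by rewrite -valencyE valC kE.
have sum0 (F : C -> R) : (forall w, F w = 0) -> \sum_w F w = 0.
  by move=> F0; apply: big1 => w _.
(* From here on [K] is an opaque nonzero scalar, an atom for [field]. *)
clearbody K; move=> [[[]|t]|] [[[]|t']|]; rewrite sum_cone_vertex /= !cone_valencyE ?cardCR ?valR.
- by rewrite sum0 => [|w]; [field | rewrite mul0r].
- by rewrite sum0 => [|w]; [field | rewrite mul0r].
- by rewrite sum0 => [|w]; [field | rewrite mul0r].
- by rewrite sum0 => [|w]; [field | rewrite andbF mul0r].
- have -> : (Some (inr t) == Some (inr t')
      :> cone (disjoint_union isolated_vertex C)) = (t == t') by [].
  have [<-|tt'] := eqVneq t t'.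
    rewrite (sumN t) => [|w]; last by rewrite valency_base valR [adj w t]adj_sym andbb.
    by rewrite adj_irr mulr0n mulr1n; field.
  under eq_bigr => w _ do rewrite valency_base valR.
  rewrite -mulr_suml -natr_sum -card_common_neighbors.
  have /(congr1 (fun i => i%:R : R)) := common t t' tt'.
  rewrite natrM natrD kE mulr0n; set cn := #|_|%:R => KE.
  have -> : cn = (K - 1) / 2 - (adj t t')%:R by rewrite -KE; field.
  by field.
- by rewrite (sumN t) => [|w]; [field | rewrite andbT valency_base valR].
- by rewrite sum0 => [|w]; [field | rewrite mul0r].
- rewrite (sumN t') => [|w]; first by field.
  by rewrite valency_base valR adj_sym.
- rewrite (eq_bigr (fun=> K^-1)) => [|w _]; last by rewrite valency_base valR div1r.
  have CE : #|C|%:R = 2 * K - 1 :> R by rewrite -cardCR -natr1 addrK.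
  by rewrite sumr_const -[K^-1 *+ _]mulr_natl CE; field.
Qed.

(** * Spectra of the two families *)

Lemma cone_conference_spectrum (R : rcfType) (G : sgraph) (u : G)
    (N : R := #|G|%:R) (x : R := Num.sqrt (N - 2))
    (t1 : R := (N + x) / (N - 1)) (t2 : R := (N - x) / (N - 1)) :
  (forall x : G, 0 < valency x)%N -> cone_over_isolated_and_conference G ->
  [/\ (2 < #|G|)%N, t1 != 0, t2 != 0 & t1 != t2] /\
  [/\ Lmultiplicity G (0 : R) = 1%N,
      (2 * Lmultiplicity G t1 + 1 = #|G|)%N,
      (2 * Lmultiplicity G t2 + 1 = #|G|)%N &
      forall a, Leigenvalue G a -> a \in [:: 0; t1; t2]].
Proof.
move=> valency_gt0 [C [n [k [l [mu [[cardC k_lt valC adjC nadjC] nE kE muE]]]]] GC].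
have [K KE] : exists K : R, k.+1%:R = K by exists k.+1%:R.
have K_gt0 : 0 < K by rewrite -KE ltr0n.
have K_neq0 := lt0r_neq0 K_gt0.
have NE : N = 2 * K + 1.
  rewrite /N (isomorphic_card GC) card_cone cardC nE.
  have -> : (2 * k + 1).+2 = (2 * k.+1 + 1)%N by lia.
  by rewrite natrD natrM KE.
have k_gt0 : 1 < K by rewrite -KE ltr1n ltnS; case/andP: k_lt.
have sqr_x : x ^+ 2 = 2 * K - 1 by rewrite sqr_sqrtr NE; [ring | lra].
have x_gt0 : 0 < x by rewrite sqrtr_gt0 NE; lra.
have t1E : t1 = (2 * K + 1 + x) / (2 * K) by rewrite /t1 NE addrK.
have t2E : t2 = (2 * K + 1 - x) / (2 * K) by rewrite /t2 NE addrK.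
have K2_neq0 : 2 * K != 0 by rewrite mulf_neq0 ?pnatr_eq0.
have t1_neq0 : t1 != 0 by rewrite t1E mulf_neq0 ?invr_eq0//; apply: lt0r_neq0; lra.
have t2_neq0 : t2 != 0 by rewrite t2E mulf_neq0 ?invr_eq0//; apply: lt0r_neq0; nra.
have t12 : t1 != t2.
  rewrite t1E t2E; apply/eqP => /(mulIf (invr_neq0 K2_neq0)) xNx.
  have x0 : x = 0 by lra.
  by rewrite x0 ltxx in x_gt0.
(* As [N - 1 = 2 * K], the values [1 - t1] and [1 - t2] are [(-1 - x) / (2 * K)] and
   [(-1 + x) / (2 * K)]; their sum and product give the constants of the conference cone by
   [x ^+ 2 = 2 * K - 1]. *)
have E : walk_identity G (2 - t1 - t2) ((1 - t1) * (1 - t2)) ((2 * K ^+ 2)^-1).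
  have -> : 2 - t1 - t2 = - K^-1 by rewrite t1E t2E; field.
  have -> : (1 - t1) * (1 - t2) = (1 - K) / (2 * K ^+ 2).
    have -> : (1 - t1) * (1 - t2) = (1 - x ^+ 2) / (4 * K ^+ 2).
      by rewrite t1E t2E; field.
    by rewrite sqr_x; field.
  apply: walk_identity_isomorphic GC _.
  rewrite -KE; apply: conference_cone_walk_identity => [|//|t t' tt']; first by rewrite cardC.
  have [tt'_adj|tt'_nadj] := boolP (adj t t').
    by rewrite (adjC t t')// kE muE.
  by rewrite (nadjC t t')// addn0.
split; first by split=> //; rewrite (isomorphic_card GC) card_cone cardC nE; lia.
have [m0 m12 m_trace eigL] := walk_identity_spectrum valency_gt0 u t1_neq0 t2_neq0 t12 E.
(* The multiplicities add up to [2 * K], so the trace leaves [(m1 - m2) * x = 0] with [x]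
   positive. *)
have m1_m2 : Lmultiplicity G t1 = Lmultiplicity G t2.
  apply/eqP; rewrite -(eqr_nat R) -subr_eq0.
  (* The two sides of the trivial equation are rewritten differently, one as the count of
     multiplicities and the other as [2 * K + 1]. *)
  move: m_trace; rewrite -/N; have : N = N by [].
  rewrite {1}/N -m12 !natrD NE t1E t2E.
  move: (_%:R) (_%:R) => m2 m1 m12E /(congr1 ( *%R (2 * K))) mE.
  apply/eqP/(mulIf (lt0r_neq0 x_gt0)); rewrite mul0r.
  have {}mE : (m1 + m2) * (2 * K + 1) + (m1 - m2) * x = 2 * K * (2 * K + 1).
    by rewrite -mE; field.
  have m12K : m1 + m2 = 2 * K by apply: (addIr 1).
  by apply: (addrI (2 * K * (2 * K + 1))); rewrite addr0 -[RHS]mE m12K.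
by split=> //; rewrite -m12 ?m1_m2; lia.
Qed.

Lemma star_spectrum (R : rcfType) (G : sgraph) (u : G) :
  (forall x : G, 0 < valency x)%N -> star G ->
  [/\ (0 < Lmultiplicity G (0 : R))%N, (0 < Lmultiplicity G (1 : R))%N,
      (0 < Lmultiplicity G (2 : R))%N &
      forall a : R, Leigenvalue G a -> a \in [:: 0; 1; 2]].
Proof.
move=> valency_gt0 [m m_ge2 Gm].
have two_neq0 : 2 != 0 :> R by rewrite pnatr_eq0.
have one_neq2 : 1 != 2 :> R by rewrite (eqr_nat R 1 2).
have E : walk_identity G (2 - 1 - 2) ((1 - 1) * (1 - 2)) (m%:R^-1 : R).
  have -> : 2 - 1 - 2 = -1 :> R by ring.
  rewrite subrr mul0r; apply: walk_identity_isomorphic Gm _.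
  by apply: star_walk_identity; apply: leq_trans m_ge2.
have [m0 m12 m_trace eigL] :=
  walk_identity_spectrum valency_gt0 u (oner_neq0 R) two_neq0 one_neq2 E.
have {}m_trace : (Lmultiplicity G (1 : R) + Lmultiplicity G (2 : R) * 2 = #|G|)%N.
  by apply/eqP; rewrite -(eqr_nat R) -m_trace natrD natrM mulr1.
have := isomorphic_card Gm; rewrite card_sum !card_ord => cardG.
(* The multiplicities [i], [j] of 1 and 2 satisfy [i + j = m] and [i + 2 * j = m + 1]; the
   assumption [2 <= m] makes [i = m - 1] positive. *)
have [m1 m2] : Lmultiplicity G (1 : R) = m.-1 /\ Lmultiplicity G (2 : R) = 1%N.
  move: m_trace m12; rewrite cardG.
  by move: (Lmultiplicity _ _) (Lmultiplicity _ _) => i j; lia.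
by rewrite m0 m1 m2 -subn1 subn_gt0.
Qed.

(** * Graphs with a leaf and three eigenvalues: both directions and the multiplicities *)

Theorem proposition7 (R : rcfType) (G : sgraph) (n : nat)
    (Gconn : connected G) (Gmin : minimum_valency G 1) (Gn : #|G| = n) :
  (number_of_Leigenvalues R G 3 <->
     star G \/ cone_over_isolated_and_conference G) /\
  (cone_over_isolated_and_conference G ->
     let theta1 : R := (n%:R + Num.sqrt (n%:R - 2)) / (n%:R - 1) in
     let theta2 : R := (n%:R - Num.sqrt (n%:R - 2)) / (n%:R - 1) in
     [/\ forall a : R, nontrivial_Leigenvalue G a <-> a = theta1 \/ a = theta2,
         (Lmultiplicity G theta1)%:R = (n%:R - 1) / 2 :> R &
         (Lmultiplicity G theta2)%:R = (n%:R - 1) / 2 :> R]).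
Proof.
case: Gmin => valency_gt0 [u valency_u].
have LeigE (a : R) : Leigenvalue G a = (0 < Lmultiplicity G a)%N.
  exact: eigenvalue_mup.
have half_gt0 (i j : nat) : (2 < j)%N -> (2 * i + 1 = j)%N -> (0 < i)%N by lia.
split; last first.
  move=> /(cone_conference_spectrum R u valency_gt0); rewrite Gn.
  move=> [[G_gt2 t1_neq0 t2_neq0 t12] [m0 m1 m2 eigL]] theta1 theta2.
  have multE (i : nat) : (2 * i + 1 = n)%N -> i%:R = (n%:R - 1) / 2 :> R.
    by move=> <-; rewrite natrD natrM; field.
  split; [move=> a | exact: (multE _ m1) | exact: (multE _ m2)].
  split=> [[/eigL] | ].
    by rewrite !inE => /or3P[]/eqP -> //; [rewrite eqxx | left | right].
  case=> ->; split=> //; rewrite LeigE.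
    exact: (half_gt0 _ _ G_gt2 m1).
  exact: (half_gt0 _ _ G_gt2 m2).
(* Positive multiplicity certifies that each of the three listed values does occur. *)
have three (t1 t2 : R) : t1 != 0 -> t2 != 0 -> t1 != t2 ->
    (forall a : R, a \in [:: 0; t1; t2] -> (0 < Lmultiplicity G a)%N) ->
    (forall a : R, Leigenvalue G a -> a \in [:: 0; t1; t2]) ->
    number_of_Leigenvalues R G 3.
  move=> t1_neq0 t2_neq0 t12 mult eigL; exists [:: 0; t1; t2]; split=> //.
    by rewrite /= !inE negb_or ![0 == _]eq_sym t1_neq0 t2_neq0 t12.
  by move=> a; split=> [/eigL//|/mult]; rewrite LeigE.
split.
  move=> /(three_Leigenvalues_walk_identity valency_gt0 u Gconn).
  case=> cardG [a [b [c [c_neq0 E]]]].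
  have [C GC] := leaf_walk_identity_cone valency_gt0 valency_u c_neq0 E.
  have C_gt0 : (0 < #|C|)%N by move: cardG; rewrite (isomorphic_card GC) card_cone.
  (* On the cone itself the identity splits into an edgeless base, which gives a star, and a
     conference graph. *)
  have E' := walk_identity_isomorphic (isomorphic_sym GC) E.
  have [C0|C_conf] := cone_walk_identity_conference c_neq0 C_gt0 E'.
    left; have [m m_ge2 Cm] := cone_edgeless_star C_gt0 C0.
    by exists m => //; apply: isomorphic_trans Cm.
  by right; exists C.
case=> [/(star_spectrum R u valency_gt0)[m0 m1 m2 eigL] | ].
  apply: (three 1 2 _ _ _ _ eigL); [by rewrite oner_neq0 | by rewrite pnatr_eq0 | |].
    by rewrite (eqr_nat R 1 2).
  by move=> a; rewrite !inE => /or3P[]/eqP ->; [exact: m0 | exact: m1 | exact: m2].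
move=> /(cone_conference_spectrum R u valency_gt0) [[G_gt2 t1_neq0 t2_neq0 t12] [m0 m1 m2 eigL]].
apply: (three _ _ t1_neq0 t2_neq0 t12 _ eigL).
move=> a; rewrite !inE => /or3P[]/eqP ->; first by rewrite m0.
  exact: (half_gt0 _ _ G_gt2 m1).
exact: (half_gt0 _ _ G_gt2 m2).
Qed.
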